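(* Let $t\leq m$ be positive integers and $(\mathbb{F}_{2^m},+,\star)$ a left pre-quasifield. Let $\tau:\mathbb{F}_{2^m}\to\mathbb{F}_{2^t}$ be surjective and $\mathbb{F}_2$-linear, $\sigma:\mathbb{F}_{2^m}\to\mathbb{F}_{2^m}$ invertible, and $h:\mathbb{F}_{2^m}\to\mathbb{F}_{2^t}$ arbitrary. Then \[ f(x,y)=\tau\big(\sigma(y)\star x\big)+h(y),\qquad x,y\in\mathbb{F}_{2^m}, \] is a $(2m,t)$-bent function.
   Context: A left pre-quasifield is a triple $(Q,+,\star)$ where $(Q,+)$ is a finite abelian group (here the additive group of $\mathbb{F}_{2^m}$) and $\star:Q\times Q\to Q$ satisfies: (1) $x\star 0=0\star x=0$; (2) $x\star(y+z)=x\star y+x\star z$; (3) for every $a\neq 0$ the maps $x\mapsto x\star a$ and $x\mapsto a\star x$ are bijective. Identifying the domain with $\mathbb{F}_2^{n}$ ($n=2m$) and codomain with $\mathbb{F}_2^t$, an $(n,t)$-function $F$ is $(n,t)$-bent if every component function $x\mapsto v\cdot F(x)$, $v\in\mathbb{F}_2^t\setminus\{0\}$, is a bent Boolean function, i.e. $\sum_x(-1)^{v\cdot F(x)+a\cdot x}=\pm2^{n/2}$ for all $a\in\mathbb{F}_2^n$ and all $v\neq0$. *)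

(* Defs.v *)
(* MathComp world. *)
From HB Require Import structures.
From mathcomp Require Import all_boot all_order all_fingroup all_algebra.
From mathcomp Require Import all_solvable all_field.

Set Implicit Arguments.
Unset Strict Implicit.
Unset Printing Implicit Defensive.

Import GRing.Theory.
Local Open Scope ring_scope.

Definition left_prequasifield (Q : finZmodType) (star : Q -> Q -> Q) : Prop :=
  [/\ forall x, star x 0 = 0 /\ star 0 x = 0,
      forall x y z, star x (y + z) = star x y + star x z
    & forall a, a != 0 ->
        bijective (fun x => star x a) /\ bijective (fun x => star a x)].

Definition dotp (n : nat) (u v : 'rV['F_2]_n) : 'F_2 :=
  \sum_(i < n) u 0 i * v 0 i.

(* The exponent is the representative in {0, 1} of an element of 'F_2. *)
Definition walsh (n : nat) (g : 'rV['F_2]_n -> 'F_2) (a : 'rV['F_2]_n) : int :=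
  \sum_(x : 'rV['F_2]_n) (-1) ^+ nat_of_ord (g x + dotp a x).

(* For odd n the real number 2^(n/2) is irrational, so no integer sum equals it
   up to sign; the parity condition makes n./2 the exact half of n. *)
Definition bent (n : nat) (g : 'rV['F_2]_n -> 'F_2) : Prop :=
  ~~ odd n /\
  forall a, walsh g a = 2 ^+ n./2 \/ walsh g a = - 2 ^+ n./2.

Definition vectorial_bent (n t : nat) (F : 'rV['F_2]_n -> 'rV['F_2]_t) : Prop :=
  forall v, v != 0 -> bent (fun x => dotp v (F x)).

(* Bentness of a function between abstract 'F_2-spaces, read in coordinates.
   It is required for every choice of linear coordinates on the domain and on
   the codomain.  The dimension conditions guarantee that such coordinates
   exist, so that the quantification is never vacuous. *)
Definition nt_bent (n t : nat) (V W : vectType 'F_2) (f : V -> W) : Prop :=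
  [/\ \dim {:V} = n, \dim {:W} = t
    & forall (phi : {linear 'rV['F_2]_n -> V}) (psi : {linear W -> 'rV['F_2]_t}),
        bijective phi -> bijective psi ->
        vectorial_bent (fun x => psi (f (phi x)))].

(* Main.v *)
(* Let lam = v . tau and let a be the character's linear part in x.
   For fixed y the exponent is additive in x up to a constant, so the inner sum
   over x is 0 unless the functional x |-> lam (sigma y * x) + a x vanishes, in
   which case it is +-2^m.  Hence it suffices that exactly one s makes
   x |-> lam (s * x) + a x vanish.  As star is not additive in s, uniqueness is
   not immediate; instead the number of such s is found by summing
   (-1)^(lam (s * x) + a x) over s first: s |-> s * x is a bijection for x != 0,
   so only x = 0 contributes. *)
Require Import Defs.
From HB Require Import structures.
From mathcomp Require Import all_boot all_order all_fingroup all_algebra.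
From mathcomp Require Import all_solvable all_field.

Set Implicit Arguments.
Unset Strict Implicit.
Unset Printing Implicit Defensive.

Import GRing.Theory Num.Theory.
Local Open Scope ring_scope.

(** The nontrivial additive character of the two-element field. *)
Definition chi (u : 'F_2) : int := (-1) ^+ nat_of_ord u.

Lemma chiD u v : chi (u + v) = chi u * chi v.
Proof. by case: u => [[|[|u]] ?]; case: v => [[|[|v]] ?]. Qed.

Lemma chi_neq0 u : u != 0 -> chi u = -1.
Proof. by case: u => [[|[|u]] ?]. Qed.

Lemma chi_sign u : chi u = 1 \/ chi u = -1.
Proof. by case: u => [[|[|u]] ?]; [left | right |]. Qed.

(** Translation by a point where [g] is nonzero flips every sign, so the sum equals its own
    negative. *)
Lemma sum_chi_eq0 (Q : finZmodType) (g : Q -> 'F_2) :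
  {morph g : x y / x + y} -> (exists x, g x != 0) -> \sum_x chi (g x) = 0.
Proof.
move=> gD [x0 gx0]; set S := \sum_x _.
have: S = - S.
  rewrite {1}/S (reindex_inj (addrI x0)) /= -sumrN; apply: eq_bigr => x _.
  by rewrite gD chiD chi_neq0 // mulN1r.
by move/eqP; rewrite -addr_eq0 -mulr2n mulrn_eq0 => /eqP.
Qed.

Lemma sum_chiE (Q : finZmodType) (g : Q -> 'F_2) :
  {morph g : x y / x + y} ->
  \sum_x chi (g x) = #|Q|%:R * [forall x, g x == 0]%:R.
Proof.
move=> gD; case: forallP => [g0 | /forallP].
  rewrite (eq_bigr (fun=> 1)) => [|x _]; last by rewrite (eqP (g0 x)).
  by rewrite mulr1 sumr_const.
rewrite negb_forall => /existsP gN0.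
by rewrite mulr0 sum_chi_eq0.
Qed.

Section Prequasifield.

Variables (Q : finZmodType) (star : Q -> Q -> Q) (lam a : Q -> 'F_2).
Hypothesis starP : left_prequasifield star.
Hypotheses (lamD : {morph lam : x y / x + y}) (lamN0 : exists x, lam x != 0).
Hypothesis aD : {morph a : x y / x + y}.

Let phase s x := lam (star s x) + a x.

Let phaseD s : {morph phase s : x y / x + y}.
Proof.
by case: starP => _ starD _ x y; rewrite /phase starD lamD aD addrACA.
Qed.

Lemma prequasifield_functional_unique :
  exists s0, forall s, [forall x, phase s x == 0] = (s == s0).
Proof.
case: (starP) => star0 _ star_bij.
have a0 : a 0 = 0 by apply: (addrI (a 0)); rewrite -aD !addr0.
have lam0 : lam 0 = 0 by apply: (addrI (lam 0)); rewrite -lamD !addr0.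
have Q_neq0 : #|Q|%:R != 0 :> int.
  by rewrite pnatr_eq0 -lt0n; apply/card_gt0P; exists 0.
have total : \sum_s \sum_x chi (phase s x) = #|Q|%:R.
  rewrite exchange_big (bigD1 0) //= [X in _ + X]big1 => [|x xN0].
    rewrite addr0 (eq_bigr (fun=> 1)) ?sumr_const // => s _.
    by rewrite /phase (star0 s).1 lam0 a0.
  have [starx_bij _] := star_bij x xN0.
  under eq_bigr do rewrite chiD.
  rewrite -mulr_suml [X in X * _](_ : _ = 0) ?mul0r //.
  apply: etrans (sum_chi_eq0 lamD lamN0).
  by rewrite [RHS](reindex (star^~ x)) //=; exact: onW_bij.
pose N := #|[pred s | [forall x, phase s x == 0]]|.
(* The same double sum with [x] innermost: each [s] contributes [#|Q|] if its functional vanishes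
   and 0 otherwise. Cancelling [#|Q|] leaves [N = 1]. *)
have : #|Q|%:R * N%:R = #|Q|%:R :> int.
  rewrite -[RHS]total -[N]sum1_card natr_sum mulr_sumr big_mkcond /=.
  apply: eq_bigr => s _.
  by rewrite sum_chiE // inE; case: ifP; rewrite ?mulr1 ?mulr0.
rewrite -[RHS]mulr1 => /(mulfI Q_neq0)/eqP; rewrite pnatr_eq1.
by case/card1P => s0 s0P; exists s0 => s; have := s0P s; rewrite !inE.
Qed.

(** Only one [y] survives the inner summation, so [g] affects nothing but the sign; it can therefore
    be arbitrary. *)
Lemma prequasifield_walsh (sigma : Q -> Q) (g : Q -> 'F_2) :
  bijective sigma ->
  let S := \sum_(p : Q * Q)
             chi (lam (star (sigma p.2) p.1) + a p.1 + g p.2) in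
  S = #|Q|%:R \/ S = - #|Q|%:R.
Proof.
move=> sigma_bij S; have [s0 s0P] := prequasifield_functional_unique.
have [sigmaV sigmaK sigmaVK] := sigma_bij.
have -> : S = #|Q|%:R * chi (g (sigmaV s0)).
  rewrite /S -(pair_bigA _ (fun x y => chi (phase (sigma y) x + g y))) /=.
  rewrite exchange_big /= (bigD1 (sigmaV s0)) //= [X in _ + X]big1 => [|y yN].
    under eq_bigr do rewrite chiD.
    by rewrite -mulr_suml sum_chiE // s0P sigmaVK eqxx mulr1 addr0.
  under eq_bigr do rewrite chiD.
  rewrite -mulr_suml sum_chiE // s0P (can2_eq sigmaK sigmaVK) (negPf yN).
  by rewrite mulr0 mul0r.
by case: (chi_sign (g (sigmaV s0))) => ->; rewrite ?mulr1 ?mulrN1; [left|right].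
Qed.

End Prequasifield.

Lemma dotpDr n (u : 'rV['F_2]_n) : {morph dotp u : x y / x + y}.
Proof.
move=> x y; rewrite /dotp -big_split; apply: eq_bigr => i _.
by rewrite mxE mulrDr.
Qed.

Lemma dotp_neq0 n (v : 'rV['F_2]_n) : v != 0 -> exists w, dotp v w != 0.
Proof.
move=> /rV0Pn[i vi]; exists (delta_mx 0 i).
rewrite /dotp (bigD1 i) //= big1 => [|j jNi]; last first.
  by rewrite mxE (negPf jNi) andbF mulr0.
by rewrite mxE !eqxx mulr1 addr0.
Qed.

(* The field with 2^m elements is a field extension of 'F_2 of degree m;
   finvect_type K is K itself with its (finite) additive group structure. *)
Theorem theorem4 (m t : nat) (m_gt0 : (0 < m)%N) (t_gt0 : (0 < t)%N)
    (le_tm : (t <= m)%N)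
    (K L : fieldExtType 'F_2) (dimK : \dim {:K} = m) (dimL : \dim {:L} = t)
    (star : K -> K -> K) (star_lpq : @left_prequasifield (finvect_type K) star)
    (tau : {linear K -> L}) (tau_surj : forall z : L, exists x : K, tau x = z)
    (sigma : K -> K) (sigma_bij : bijective sigma)
    (h : K -> L) :
  nt_bent (2 * m) t (fun p : K * K => tau (star (sigma p.2) p.1) + h p.2).
Proof.
have dimKK : \dim {: (K * K)%type} = (2 * m)%N.
  by rewrite mul2n -addnn -dimK !dimvf.
split=> // phi psi phi_bij [psiV psiK psiVK] v vN0; split=> [|a].
  by rewrite mul2n odd_double.
have [phiV phiK phiVK] := phi_bij.
pose Q := finvect_type K.
pose lam (z : Q) := dotp v (psi (tau z)).
pose l (p : Q * Q) := dotp a (phiV p).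
(* [phiV] is only known as an inverse function, so its additivity is checked after applying the
   injective linear map [phi]. *)
have lD x1 x2 y1 y2 : l (x1 + x2, y1 + y2) = l (x1, y1) + l (x2, y2).
  rewrite /l -dotpDr; congr dotp; apply: (can_inj phiK).
  by rewrite linearD !phiVK.
have lamD : {morph lam : x y / x + y}.
  by move=> x y; rewrite /lam -dotpDr !linearD.
(* A vector not orthogonal to [v] is pulled back through [psi], then through [tau] by
   surjectivity. *)
have lamN0 : exists x, lam x != 0.
  have [w vw] := dotp_neq0 vN0; have [x tau_x] := tau_surj (psiV w).
  by exists x; rewrite /lam tau_x psiVK.
have l1D : {morph (fun x => l (x, 0)) : x y / x + y}.
  by move=> x y; rewrite -lD addr0.
(* The free function of [y] absorbs both [h] and the part of the character depending on [y]. *)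
have := @prequasifield_walsh Q star lam _ star_lpq lamD lamN0 l1D sigma
  (fun y => dotp v (psi (h y)) + l (0, y)) sigma_bij.
have -> : #|Q|%:R = 2 ^+ (2 * m)./2 :> int.
  rewrite mul2n doubleK -natrX -dimK; congr (_%:R).
  by rewrite -(@card_vspacef 'F_2 Q (Vector.class Q)) card_vspace card_Fp.
(* [phi] is retyped with the finite codomain [Q * Q], so that it can reindex the sum. *)
pose Phi (x : 'rV['F_2]_(2 * m)) : Q * Q := phi x.
have Phi_bij : bijective Phi by exists phiV.
have l_phi x : dotp a x = l ((phi x).1, 0) + l (0, (phi x).2).
  by rewrite -lD addr0 add0r -surjective_pairing /l phiK.
rewrite /walsh; set S := \sum_p _; set W := \sum_x _; suff -> : S = W by [].
rewrite /S (reindex Phi) /=; last exact: onW_bij.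
apply: eq_bigr => x _; rewrite /chi /lam; congr (_ ^+ nat_of_ord _).
by rewrite linearD dotpDr l_phi addrACA.
Qed.
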